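(* Let $G$ be a finite nilpotent group of odd order. For each prime $p$, let $e_p$ be the maximal integer $e\ge 0$ such that the center $Z(G)$ contains a subgroup isomorphic to the elementary abelian group $\mathbb{F}_p^{e}$. Let $X$ be a minimal faithful permutation representation of $G$. Then: (1) the number of orbits for the $G$-action on $X$ is $\sum_p e_p$ (sum over all primes $p$); (2) the multiset of sizes of the $G$-orbits on $X$ is a group isomorphism invariant; that is, if $G'$ is a group isomorphic to $G$ and $X'$ is any minimal faithful permutation representation of $G'$, then the multiset of sizes of the $G'$-orbits on $X'$ equals the multiset of sizes of the $G$-orbits on $X$.
   Context: A minimal faithful permutation representation of a finite group $G$ is a finite set $X$ with a faithful action of $G$ such that $|X|$ is the smallest possible among all sets on which $G$ acts faithfully. (The empty set is allowed and is the minimal faithful set for the trivial group.) *)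

(* Defs.v *)
From HB Require Import structures.
From mathcomp Require Import all_boot all_order all_algebra.
From mathcomp Require Import all_fingroup all_solvable.

Set Implicit Arguments.
Unset Strict Implicit.
Unset Printing Implicit Defensive.

Import GroupScope.

(* The competing actions are actions of G itself ([action G T']), not only
   actions of the ambient type gT restricted to G. *)
Definition minimal_faithful (gT : finGroupType) (G : {group gT})
    (T : finType) (to : action G T) : Prop :=
  [faithful G, on [set: T] | to]
  /\ forall (T' : finType) (to' : action G T'),
       [faithful G, on [set: T'] | to'] -> #|T| <= #|T'|.

Definition orbits (gT : finGroupType) (G : {group gT})
    (T : finType) (to : action G T) : {set {set T}} :=
  [set orbit to G x | x in [set: T]].

(* The multiset of orbit sizes, as a sequence to be compared with perm_eq. *)
Definition orbit_sizes (gT : finGroupType) (G : {group gT})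
    (T : finType) (to : action G T) : seq nat :=
  [seq #|B| | B : {set T} <- enum (orbits to)].

(* The group F_p^e is the additive group of row vectors. Only meaningful for p
   prime. The bound on e loses nothing, since e < p ^ e <= #|G| for every e
   satisfying the condition. *)
Definition center_rank (gT : finGroupType) (G : {group gT}) (p : nat) : nat :=
  \max_(e < #|G|.+1 | [exists E : {group gT},
      (E \subset 'Z(G)) && (E \isog [set: 'rV['F_p]_e])]) e.

(* Main.v *)
Require Import Defs.
From HB Require Import structures.
From mathcomp Require Import all_boot all_order all_algebra.
From mathcomp Require Import all_fingroup all_solvable.
From mathcomp Require mxabelem.

Set Implicit Arguments.
Unset Strict Implicit.
Unset Printing Implicit Defensive.

Import GroupScope.

(** Let S be the subgroup generated by the elements of prime order of Z(G).
    Since G is nilpotent, a normal subgroup that meets S trivially is trivial,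
    so a G-set with point stabilisers H_1, ..., H_n (one for each orbit) is
    faithful if and only if S, H_1, ..., H_n intersect trivially.  A minimal
    faithful G-set is therefore a family of subgroups with this property whose
    sum of indices is least ([minimal_family_of_action]).

    When G has odd order, each member H of a minimal family cuts S in a subgroup
    of prime index ([minimal_family_prime_trace]): otherwise H could be
    discarded, or replaced by two overgroups that intersect in H and whose
    indices add up to at most 2/3 of that of H.  Intersecting S with such
    subgroups one after the other, each step either changes nothing or removes
    exactly one prime factor from the order ([Omega_capI]).  In a minimal family
    no step is wasted, so the number of members is the number of prime factors
    of |S| ([size_minimal_family]).  As S is the product over p of the largest
    elementary abelian p-subgroups of Z(G), that number is the sum of the e_p
    ([socle_center_rank]).

    The families with prime traces behave like spanning sets of a matroid, whose
    bases of least weight all have the same multiset of weights.  The usual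
    exchange shows that two minimal families have equally many members of index
    at most t, for every t ([count_minimal_family]), so they have the same
    multiset of indices.  As indices are orbit sizes and families can be
    transported along isomorphisms, the second claim follows. *)

(** * Counting prime factors *)

(** For N at least every prime factor of n, this is the number of prime factors
    of n counted with multiplicity.  The fixed bound makes additivity a
    termwise statement about one index range. *)
Definition Omega (N n : nat) : nat := (\sum_(p < N.+1 | prime p) logn p n)%N.

Lemma Omega1 N : Omega N 1 = 0.
Proof. by apply: big1 => p _; rewrite logn1. Qed.

Lemma OmegaM N m n : 0 < m -> 0 < n -> Omega N (m * n) = Omega N m + Omega N n.
Proof.
move=> m_gt0 n_gt0; rewrite /Omega -big_split /=.
by apply: eq_bigr => p _; rewrite lognM.
Qed.

Lemma Omega_prime N q : prime q -> q <= N -> Omega N q = 1%N.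
Proof.
move=> pr_q leqN; rewrite /Omega.
have ltqN : q < N.+1 by [].
rewrite (bigD1 (Ordinal ltqN)) //= logn_prime // eqxx big1 ?addn0 // => p.
by case/andP=> _; rewrite logn_prime // -val_eqE /= => /negPf->.
Qed.

Lemma Omega_subgroup N (gT : finGroupType) (H K : {group gT}) :
  H \subset K -> Omega N #|H| <= Omega N #|K|.
Proof. by move=> sHK; rewrite -(Lagrange sHK) OmegaM ?leq_addr. Qed.

(** * The socle of the centre *)

(** For nilpotent G, the subgroup generated by the minimal normal subgroups. *)
Definition socle (gT : finGroupType) (G : {group gT}) : {group gT} :=
  'Ohm_1('Z(G))%G.

Lemma socle_sub_center (gT : finGroupType) (G : {group gT}) :
  socle G \subset 'Z(G).
Proof. exact: Ohm_sub. Qed.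

Lemma socle_sub (gT : finGroupType) (G : {group gT}) : socle G \subset G.
Proof. exact: subset_trans (Ohm_sub _ _) (center_sub G). Qed.

Lemma socle_normalises (gT : finGroupType) (G H K : {group gT}) :
  H \subset G -> K \subset socle G -> K \subset 'N(H).
Proof.
move=> sHG /subset_trans/(_ (socle_sub_center G)) sKZ.
apply: subset_trans (cent_sub H).
by apply: subset_trans sKZ _; rewrite subIset // centS ?orbT.
Qed.

(** A normal subgroup of a nilpotent group meets the centre, hence contains a
    central element of prime order.  So an action is faithful as soon as the
    socle acts faithfully. *)
Lemma socle_meet (gT : finGroupType) (G N : {group gT}) :
  nilpotent G -> N <| G -> N :&: socle G = 1 -> N :=: 1.
Proof.
move=> nilG nsNG /TI_Ohm1 NZ1; apply/eqP/idPn=> /(meet_center_nil nilG nsNG).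
by rewrite NZ1 eqxx.
Qed.

(** The largest elementary abelian p-subgroup of the centre is the p-part of its
    socle, because the centre is abelian. *)
Lemma socle_center_rank (gT : finGroupType) (G : {group gT}) (p : nat) :
  prime p -> center_rank G p = logn p #|socle G|.
Proof.
move=> pr_p; rewrite -p_rank_abelian ?center_abelian //.
have isoE (E : {group gT}) e :
  (E \isog [set: 'rV['F_p]_e]) = (p.-abelem E && (#|E| == p ^ e)%N).
  have abV := mxabelem.mx_Fp_abelem 1 e pr_p.
  rewrite isog_sym (isog_abelem_card _ abV) cardsT card_mx card_Fp //.
  by rewrite mul1n.
apply/eqP; rewrite eqn_leq; apply/andP; split.
  apply/bigmax_leqP=> e /existsP[E /andP[sEZ]]; rewrite isoE => /andP[abE oE].
  rewrite -(pfactorK e pr_p) -(eqP oE) -/(_ <= _).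
  by rewrite logn_le_p_rank // inE sEZ.
have [E] := p_rank_witness p [group of 'Z(G)].
rewrite pnElemE // inE => /andP[EZ oE].
case/pElemP: EZ => sEZ abE.
(* the rank r lies in the range of the maximum, as r < p ^ r <= #|G| *)
have ltr : 'r_p('Z(G)) < #|G|.+1.
  rewrite ltnS (leq_trans _ (subset_leq_card (center_sub G))) //.
  rewrite (leq_trans _ (subset_leq_card sEZ)) // (eqP oE) ltnW //.
  by rewrite ltn_expl ?prime_gt1.
apply: (leq_trans _ (@leq_bigmax_cond _ _ _ (Ordinal ltr) _)) => //.
by apply/existsP; exists E; rewrite sEZ isoE abE.
Qed.

Lemma Omega_socle (gT : finGroupType) (G : {group gT}) :
  Omega #|G| #|socle G| = (\sum_(p < #|G|.+1 | prime p) center_rank G p)%N.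
Proof. by apply: eq_bigr => p pr_p; rewrite socle_center_rank. Qed.

(** * Faithful families of subgroups *)

(** Intersecting one member at a time makes the successive partial
    intersections, whose lengths drive the argument, available to induction. *)
Definition cap (gT : finGroupType) :
    {group gT} -> seq {group gT} -> {group gT} :=
  foldl (fun L H => (L :&: H)%G).

Lemma mem_cap (gT : finGroupType) (L : {group gT}) hs x :
  (x \in cap L hs) = (x \in L) && all (fun H : {group gT} => x \in H) hs.
Proof.
elim: hs L => [|H hs IHhs] L /=; first by rewrite andbT.
by rewrite IHhs inE andbA.
Qed.

Lemma cap_cat (gT : finGroupType) (L : {group gT}) s1 s2 :
  cap L (s1 ++ s2) = cap (cap L s1) s2.
Proof. exact: foldl_cat. Qed.

Lemma cap_sub (gT : finGroupType) (L : {group gT}) hs : cap L hs \subset L.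
Proof. by apply/subsetP=> x; rewrite mem_cap => /andP[]. Qed.

Lemma cap_perm (gT : finGroupType) (L : {group gT}) s1 s2 :
  perm_eq s1 s2 -> cap L s1 = cap L s2.
Proof.
by move=> eq12; apply/group_inj/setP=> x; rewrite !mem_cap (perm_all _ eq12).
Qed.

Definition degree (gT : finGroupType) (G : {group gT}) (hs : seq {group gT}) :
  nat := (\sum_(H <- hs) #|G : H|)%N.

Lemma degree_cons (gT : finGroupType) (G H : {group gT}) hs :
  degree G (H :: hs) = #|G : H| + degree G hs.
Proof. exact: big_cons. Qed.

Lemma degree_cat (gT : finGroupType) (G : {group gT}) s1 s2 :
  degree G (s1 ++ s2) = degree G s1 + degree G s2.
Proof. exact: big_cat. Qed.

(** Encodes a faithful action of a nilpotent group up to isomorphism: the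
    members are point stabilisers, one for each orbit, and the kernel of the
    action meets the socle in the intersection below, because the socle is
    central. *)
Definition faithful_family (gT : finGroupType) (G : {group gT}) hs : bool :=
  all (fun H : {group gT} => H \subset G) hs && (cap (socle G) hs \subset [1]).

Definition minimal_family (gT : finGroupType) (G : {group gT}) hs : Prop :=
  faithful_family G hs
  /\ forall hs', faithful_family G hs' -> degree G hs <= degree G hs'.

Lemma minimal_family_perm (gT : finGroupType) (G : {group gT}) s1 s2 :
  perm_eq s1 s2 -> minimal_family G s1 -> minimal_family G s2.
Proof.
move=> eq12; rewrite /minimal_family /faithful_family (perm_all _ eq12).
by rewrite (cap_perm _ eq12) /degree (perm_big _ eq12).
Qed.

(** Each discarded member had index above t, and at least one is discarded. *)
Lemma degree_subseq (gT : finGroupType) (G : {group gT}) t s hs :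
  subseq s hs -> size s < size hs ->
  all (fun H : {group gT} => t < #|G : H|) hs ->
  degree G s + t < degree G hs.
Proof.
have le_sub (s' hs' : seq {group gT}) :
    subseq s' hs' -> degree G s' <= degree G hs'.
  elim: hs' s' => [|H hs' IH] [|K s'] //=.
    by rewrite /degree big_nil.
  case: eqP => [-> /IH | _ /IH]; rewrite !degree_cons.
    by rewrite leq_add2l.
  by move=> le_s; rewrite (leq_trans le_s) ?leq_addl.
elim: hs s => [|H hs IHhs] [|K s] //=.
  move=> _ _ /andP[tH _]; rewrite {1}/degree big_nil degree_cons add0n.
  exact: leq_trans tH (leq_addr _ _).
rewrite ltnS; case: eqP => [-> | _] ss lts /andP[tH ths].
  have := IHhs s ss lts ths; rewrite !degree_cons -addnA.
  by rewrite ltn_add2l.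
rewrite [degree G (H :: _)]degree_cons addnC -addSn.
by apply: leq_add => //; apply: le_sub.
Qed.

(** * Intersections with subgroups of prime trace on the socle *)

Definition prime_trace (gT : finGroupType) (G H : {group gT}) : bool :=
  (H \subset G) && prime #|socle G : socle G :&: H|.

(** The index of L :&: H in L divides the prime index of socle G :&: H in the
    socle, so every partial intersection either stays put or loses exactly one
    prime factor.  This is the rank function behind the exchange argument. *)
Lemma Omega_capI (gT : finGroupType) (G L H : {group gT}) :
  prime_trace G H -> L \subset socle G ->
  Omega #|G| #|L| = ~~ (L \subset H) + Omega #|G| #|L :&: H|.
Proof.
case/andP=> sHG pr_S sLS; have [sLH | nsLH] := boolP (L \subset H).
  by rewrite (setIidPl sLH).
rewrite -(Lagrange (subsetIl L H)) OmegaM ?cardG_gt0 // addnC; congr (_ + _).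
suff -> : #|L : L :&: H| = #|socle G : socle G :&: H|.
  apply: Omega_prime => //; apply: dvdn_leq => //.
  exact: dvdn_trans (dvdn_indexg _ _) (cardSg (socle_sub G)).
have nHS := socle_normalises sHG (subxx (socle G)).
have nHL := socle_normalises sHG sLS.
have/primeP[_ dv] := pr_S.
have : #|L : L :&: H| %| #|socle G : socle G :&: H|.
  (* the two indices are the orders of L / H and of socle G / H *)
  by rewrite !indexgI -!card_quotient // cardSg // quotientS.
by case/dv/pred2P=> // /eqP; rewrite indexg_eq1 subsetI subxx (negPf nsLH).
Qed.

Lemma Omega_cap_le (gT : finGroupType) (G L : {group gT}) hs :
  all (prime_trace G) hs ->
  L \subset socle G ->
  Omega #|G| #|L| <= size hs + Omega #|G| #|cap L hs|.
Proof.
elim: hs L => //= H hs IHhs L /andP[prH prhs] sLS.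
rewrite (Omega_capI prH sLS) addSn -add1n leq_add ?leq_b1 //.
by apply: IHhs => //; apply: subset_trans (subsetIl _ _) sLS.
Qed.

(** Drop from the list every member that contains the intersection of the
    preceding ones: each remaining step then costs exactly one prime factor, so
    the number of survivors is forced. *)
Lemma irredundant_subfamily (gT : finGroupType) (G L : {group gT}) hs :
  all (prime_trace G) hs ->
  L \subset socle G ->
  exists s, [/\ subseq s hs, cap L s = cap L hs
    & size s + Omega #|G| #|cap L hs| = Omega #|G| #|L| ].
Proof.
elim: hs L => /= [|H hs IHhs] L; first by exists [::].
case/andP=> prH prhs sLS.
have sLHS : L :&: H \subset socle G by apply: subset_trans (subsetIl _ _) sLS.
have [s [ss eqs szs]] := IHhs (L :&: H)%G prhs sLHS.
rewrite (Omega_capI prH sLS) -szs.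
have [sLH | nsLH] := boolP (L \subset H).
  exists s; split=> //; first exact: subseq_trans ss (subseq_cons hs H).
  rewrite -eqs; congr (cap _ s); apply: group_inj; symmetry.
  exact/setIidPl.
by exists (H :: s); split; rewrite //= ?eqxx.
Qed.

(** * Minimal families *)

(** This is where oddness enters.  A member H containing the socle is useless.
    Otherwise take a of prime order in the socle outside H; if H<a> contains the
    socle, the trace of H has index #[a].  If it does not, take b of prime order
    in the socle outside H<a>.  Then H<a> and H<b> intersect in H, so they may
    replace H; their indices add up to |G : H| (1/#[a] + 1/#[b]), and this is at
    most 2/3 |G : H| because #[a] and #[b] are at least 3. *)
Lemma minimal_family_prime_trace (gT : finGroupType) (G : {group gT}) hs :
  odd #|G| -> minimal_family G hs ->
  all (prime_trace G) hs.
Proof.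
move=> oddG min_hs; apply/allP=> H Hhs.
have {}min_hs := minimal_family_perm (perm_to_rem Hhs) min_hs.
set s := rem H hs in min_hs.
have [/andP[sHsG cap1] le_hs] := min_hs.
have /= /andP[sHG sG] := sHsG; rewrite /prime_trace sHG /=.
have prime_gen (K : {group gT}) : ~~ (socle G \subset K) ->
    exists2 a, a \in socle G & prime #[a] && (a \notin K).
  move=> nsSK; have : ~~ ([set x in socle G | prime #[x]] \subset K).
    apply: contra nsSK; rewrite -gen_subG -Ohm1Eprime Ohm_id.
    by [].
  case/subsetPn=> a; rewrite inE => /andP[aS pra] naK; exists a => //.
  by rewrite pra.
have nsSH : ~~ (socle G \subset H).
  apply/negP=> sSH.
  have : faithful_family G s.
    rewrite /faithful_family sG; apply: subset_trans cap1.
    apply/subsetP=> x; rewrite !mem_cap => /andP[xS sx].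
    by rewrite xS [all _ _]/= (subsetP sSH _ xS).
  move/le_hs; rewrite degree_cons leqNgt.
  by rewrite -[X in X < _]add0n ltn_add2r indexg_gt0.
have [a aS /andP[pra naH]] := prime_gen H nsSH.
have ext (b : gT) : b \in socle G -> prime #[b] -> b \notin H ->
    [/\ H <*> <[b]> \subset G, H <*> <[b]> = H * <[b]>,
        H :&: <[b]> = 1 & #|G : H| = (#|G : H <*> <[b]>| * #[b])%N].
  move=> bS prb nbH.
  have sbS : <[b]> \subset socle G by rewrite cycle_subG.
  have tiHb : H :&: <[b]> = 1.
    by rewrite setIC prime_TIg // cycle_subG.
  have jE : H <*> <[b]> = H * <[b]>.
    by rewrite norm_joinEr // (socle_normalises sHG).
  have sjG : H <*> <[b]> \subset G.
    by rewrite join_subG sHG (subset_trans sbS) ?socle_sub.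
  split=> //; rewrite -(Lagrange_index sjG (joing_subl _ _)); congr (_ * _)%N.
  by rewrite -divgS ?joing_subl //= jE TI_cardMg // mulKn ?cardG_gt0.
have [sHaG HaE tiHa idxa] := ext a aS pra naH.
have [sSHa | nsSHa] := boolP (socle G \subset H <*> <[a]>).
  have nHS := socle_normalises sHG (subxx (socle G)).
  have sHSG : H <*> socle G \subset G by rewrite join_subG sHG socle_sub.
  have HSE : H <*> socle G = H <*> <[a]>.
    apply/eqP; rewrite eqEsubset !join_subG !joing_subl sSHa /=.
    by rewrite cycle_subG (subsetP (joing_subr _ _)).
  rewrite indexgI -card_quotient // -quotientYidl // HSE.
  rewrite card_quotient; last first.
    by rewrite join_subG normG (socle_normalises sHG) // cycle_subG.
  by rewrite -divgS ?joing_subl //= HaE TI_cardMg // mulKn ?cardG_gt0.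
have [b bS /andP[prb nbHa]] := prime_gen [group of H <*> <[a]>] nsSHa.
have nbH : b \notin H by apply: contra nbHa; apply/subsetP/joing_subl.
have [sHbG HbE tiHb idxb] := ext b bS prb nbH.
have ge3 c : c \in socle G -> prime #[c] -> 2 < #[c].
  move=> cS prc; rewrite odd_prime_gt2 //.
  by rewrite (oddSg _ oddG) // cycle_subG (subsetP (socle_sub G)).
suff /le_hs : faithful_family G [:: (H <*> <[a]>)%G, (H <*> <[b]>)%G & s].
  rewrite !degree_cons addnA leq_add2r /= => le_idx.
  have := ge3 a aS pra; have := ge3 b bS prb; have := indexg_gt0 G H.
  move: le_idx idxa idxb; move: #|_ : H| #|_ : H <*> <[a]>|.
  move: #|_ : H <*> <[b]>| #[a] #[b] => v p q w u le_w def_w def_w' w_gt0 q3 p3.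
  rewrite leqNgt in le_w; case/negP: le_w.
  rewrite -(ltn_pmul2l (isT : 0 < 3)) mulnDr.
  have le_p : (3 * u <= w)%N by rewrite def_w mulnC leq_mul2l p3 orbT.
  have le_q : (3 * v <= w)%N by rewrite def_w' mulnC leq_mul2l q3 orbT.
  apply: leq_ltn_trans (leq_add le_p le_q) _.
  by rewrite addnn -mul2n ltn_pmul2r.
apply/andP; split; first by rewrite /= sHaG sHbG.
apply: subset_trans cap1.
apply/subsetP=> x; rewrite !mem_cap => /andP[xS /and3P[xHa xHb xs]].
apply/and3P; split=> //.
have : x \in H * (<[b]> :&: H <*> <[a]>).
  by rewrite group_modl ?joing_subl //= -HbE inE xHb.
by rewrite prime_TIg ?mulg1 // cycle_subG.
Qed.

(** A minimal family has no redundant member, so every step of its chain of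
    partial intersections costs one prime factor, down to the trivial group. *)
Lemma size_minimal_family (gT : finGroupType) (G : {group gT}) hs :
  odd #|G| -> minimal_family G hs -> size hs = Omega #|G| #|socle G|.
Proof.
move=> oddG min_hs; have pr_hs := minimal_family_prime_trace oddG min_hs.
have [/andP[sG /trivgP cap1] le_hs] := min_hs.
have [s [ss eqs szs]] := irredundant_subfamily pr_hs (subxx _).
rewrite -szs cap1 cards1 Omega1 addn0; apply/eqP.
rewrite eqn_leq (size_subseq ss) andbT leqNgt; apply/negP=> lts.
have : faithful_family G s.
  rewrite /faithful_family eqs cap1 subxx andbT.
  by apply/allP=> H /(mem_subseq ss); apply: (allP sG).
move/le_hs; rewrite leqNgt -[degree G s]addn0 (degree_subseq ss lts) //.
by apply/allP=> H _; apply: indexg_gt0.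
Qed.

(** The exchange argument.  Suppose hs2 has more members of index at most t than
    hs1.  By length, some such member x of hs2 does not contain the intersection
    of the corresponding members of hs1.  Inserted after those members, x costs
    one prime factor, so one of the members of hs1 of index above t becomes
    redundant.  Trading it for x lowers the degree, against minimality. *)
Lemma count_minimal_family (gT : finGroupType) (G : {group gT}) hs1 hs2 t :
  odd #|G| -> minimal_family G hs1 -> minimal_family G hs2 ->
  count (fun H : {group gT} => #|G : H| <= t) hs2
    <= count (fun H : {group gT} => #|G : H| <= t) hs1.
Proof.
move=> oddG min1 min2; set low := fun H : {group gT} => #|G : H| <= t.
rewrite leqNgt; apply/negP; rewrite -!size_filter => lt12.
have permE hs : perm_eq hs (filter low hs ++ filter (predC low) hs).
  by rewrite perm_sym perm_filterC.
have pr_all hs := @minimal_family_prime_trace _ G hs oddG.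
(* each half costs at most one prime factor for each of its members, and both
   together cost as many prime factors as there are members *)
have len_low hs : minimal_family G hs ->
    Omega #|G| #|cap (socle G) (filter low hs)| = size (filter (predC low) hs).
  move=> min_hs; have := pr_all _ min_hs.
  have min_hs' := minimal_family_perm (permE hs) min_hs.
  have := size_minimal_family oddG min_hs'; rewrite size_cat.
  have [/andP[_ /trivgP cap1] _] := min_hs'; rewrite cap_cat in cap1.
  rewrite (perm_all _ (permE hs)) all_cat => szE /andP[pr_lo pr_hi].
  have := Omega_cap_le pr_lo (subxx _).
  have := Omega_cap_le pr_hi (cap_sub (socle G) (filter low hs)).
  rewrite cap1 cards1 Omega1 addn0 -szE leq_add2l => le1 le2.
  by apply/eqP; rewrite eqn_leq le1.
(* otherwise the low members of hs1 would cut out a subgroup of the one cut out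
   by those of hs2, although the latter has fewer prime factors *)
have [x x2 nsx] : exists2 x, x \in filter low hs2 &
    ~~ (cap (socle G) (filter low hs1) \subset (x : {group gT})).
  apply/hasP; rewrite has_predC; apply/negP=> sub12.
  have : cap (socle G) (filter low hs1) \subset cap (socle G) (filter low hs2).
    apply/subsetP=> z z1; rewrite mem_cap (subsetP (cap_sub _ _) _ z1) /=.
    by apply/allP=> K /(allP sub12)/subsetP/(_ z z1).
  move/(Omega_subgroup #|G|); rewrite !len_low // leqNgt.
  have := size_minimal_family oddG min1.
  rewrite -(size_minimal_family oddG min2).
  rewrite (perm_size (permE hs1)) (perm_size (permE hs2)) !size_cat => eqsz.
  by rewrite -(ltn_add2l (size (filter low hs1))) eqsz ltn_add2r lt12.
move: (x2); rewrite mem_filter => /andP[lowx xhs2].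
have prx := allP (pr_all _ min2) x xhs2.
have := pr_all _ min1.
rewrite (perm_all _ (permE hs1)) all_cat => /andP[_ pr_hi].
have min1' := minimal_family_perm (permE hs1) min1.
have [/andP[sG /trivgP cap1] le1] := min1'.
set L := cap (socle G) (filter low hs1) in nsx cap1.
have sLS : L \subset socle G := cap_sub _ _.
have sLxS : L :&: x \subset socle G by apply: subset_trans (subsetIl _ _) sLS.
have [s [ss eqs szs]] := irredundant_subfamily pr_hi sLxS.
rewrite cap_cat -/L in cap1.
have cap1x : cap (L :&: x)%G (filter (predC low) hs1) = 1 :> {set gT}.
  apply/trivgP; rewrite -cap1; apply/subsetP=> z.
  rewrite (mem_cap L) mem_cap => /andP[zLx ->]; rewrite andbT.
  exact: (subsetP (subsetIl L x) z zLx).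
have lts : size s < size (filter (predC low) hs1).
  rewrite -len_low // -/L (Omega_capI prx sLS) nsx -szs.
  by rewrite cap1x cards1 Omega1 addn0 add1n.
have : faithful_family G (filter low hs1 ++ x :: s).
  rewrite /faithful_family cap_cat /= -/L eqs cap1x subxx andbT.
  move: sG; rewrite !all_cat /= (andP prx).1 => /andP[-> shi].
  by apply/allP=> K /(mem_subseq ss); apply: (allP shi).
move/le1; rewrite !degree_cat degree_cons leq_add2l.
apply/negP; rewrite -ltnNge addnC.
have hi_t : all (fun H : {group gT} => t < #|G : H|) (filter (predC low) hs1).
  by apply/allP=> K; rewrite mem_filter /= -ltnNge => /andP[].
by apply: leq_ltn_trans (degree_subseq ss lts hi_t); rewrite leq_add2l.
Qed.

Lemma perm_eq_count_leq (s1 s2 : seq nat) :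
  (forall t, count (fun n => n <= t) s1 = count (fun n => n <= t) s2) ->
  perm_eq s1 s2.
Proof.
move=> eq_leq; apply/allP=> t _ /=; apply/eqP.
have split_leq s : count (fun n => n <= t) s
    = (count_mem t s + count (fun n => n < t) s)%N.
  rewrite -(count_predUI (pred1 t)).
  rewrite (@eq_count _ (predI _ _) pred0) ?count_pred0.
    by rewrite addn0; apply: eq_count => n /=; rewrite leq_eqVlt.
  by move=> n /=; case: eqP => //= ->; rewrite ltnn.
have eq_lt : count (fun n => n < t) s1 = count (fun n => n < t) s2.
  case: t {split_leq} => [|t]; last exact: eq_leq.
  by rewrite !(@eq_count _ _ pred0) ?count_pred0.
apply/eqP; rewrite -(eqn_add2r (count (fun n => n < t) s1)).
by rewrite {2}eq_lt -!split_leq eq_leq.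
Qed.

Lemma minimal_family_indices (gT : finGroupType) (G : {group gT}) hs1 hs2 :
  odd #|G| -> minimal_family G hs1 -> minimal_family G hs2 ->
  perm_eq [seq #|G : (H : {group gT})| | H <- hs1]
          [seq #|G : (H : {group gT})| | H <- hs2].
Proof.
move=> oddG min1 min2; apply: perm_eq_count_leq => t; rewrite !count_map.
by apply/eqP; rewrite eqn_leq !count_minimal_family.
Qed.

(** * Families and actions *)

(** One stabiliser is enough for each orbit: a central element that fixes one
    point of an orbit fixes the whole orbit. *)
Lemma family_of_action (gT : finGroupType) (G : {group gT}) (T : finType)
    (to : action G T) :
  [faithful G, on [set: T] | to] ->
  exists2 hs, faithful_family G hs
    & [seq #|G : (H : {group gT})| | H <- hs] = orbit_sizes to.
Proof.
move=> ffulG.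
(* orbits are not empty, so the default value G does not occur *)
pose stab (B : {set T}) : {group gT} :=
  if [pick x in B] is Some x then 'C_G[x | to]%G else G.
exists [seq stab B | B <- enum (orbits to)]; last first.
  rewrite -map_comp; apply/eq_in_map=> B.
  rewrite mem_enum => /imsetP[x _ ->] /=.
  rewrite /stab; case: pickP => [y yGx | /(_ x)]; last by rewrite orbit_refl.
  rewrite -card_orbit_in //; congr #|pred_of_set _|.
  exact/orbit_in_eqP.
apply/andP; split.
  apply/allP=> _ /mapP[B _ ->]; rewrite /stab.
  by case: pickP => [x _ | _] //; apply: subsetIl.
apply: subset_trans ffulG; apply/subsetP=> z; rewrite mem_cap => /andP[zS zfix].
have zG := subsetP (socle_sub G) z zS.
rewrite !inE zG; apply/subsetP=> x _; rewrite inE; apply/eqP.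
have := allP zfix (stab (orbit to G x)) (map_f _ _).
rewrite mem_enum imset_f // => /(_ isT).
rewrite /stab; case: pickP => [y yGx | /(_ x)]; last by rewrite orbit_refl.
case/setIP=> _ /astab_act/(_ (set11 y)) zy.
have /orbitP[b bG <-] : x \in orbit to G y by rewrite orbit_in_sym.
have zb : z * b = b * z.
  have /centerP[_ cz] := subsetP (socle_sub_center G) z zS.
  exact: cz.
by rewrite -!actMin // -zb actMin // zy.
Qed.

(** G acts by right translation on the disjoint union of the coset spaces. *)
Lemma action_of_family (gT : finGroupType) (G : {group gT}) hs :
  nilpotent G -> faithful_family G hs ->
  exists (T : finType) (to : action G T),
    [faithful G, on [set: T] | to] /\ #|T| = degree G hs.
Proof.
move=> nilG /andP[sG cap1].
pose n := size hs; pose K (i : 'I_n) := nth 1%G hs i.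
have sKG i : K i \subset G by apply: (allP sG); apply: mem_nth.
pose act0 (u : 'I_n * {set gT}) (a : gT) := (u.1, u.2 :* a).
have act0_1 : act0^~ 1 =1 id by case=> i A; rewrite /act0 /= rcoset1.
have act0M u : act_morph act0 u by move=> a b; rewrite /act0 /= rcosetM.
pose to0 := TotalAction act0_1 act0M.
pose P (u : 'I_n * {set gT}) := u.2 \in rcosets (K u.1) G.
(* translation by elements of G preserves the cosets that lie in G *)
have sGdom : G \subset subact_dom P to0.
  apply/subsetP=> a aG; apply/astabsP=> -[i A]; rewrite !inE /P /=.
  apply/rcosetsP/rcosetsP=> -[b bG /= defA].
    exists (b * a^-1); rewrite ?groupM ?groupV //.
    by rewrite rcosetM -defA -rcosetM mulgV rcoset1.
  by exists (b * a); rewrite ?groupM // defA rcosetM.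
exists {u | P u}, (to0^? \ sGdom)%act; split; last first.
  rewrite card_sig -sum1_card.
  rewrite (eq_bigl (fun u => true && (u.2 \in rcosets (K u.1) G))) //.
  rewrite -(pair_big_dep xpredT (fun i A => A \in rcosets (K i) G)
                         (fun _ _ => 1%N)) /=.
  rewrite /degree (big_nth 1%G) big_mkord; apply: eq_bigr => i _.
  by rewrite sum1_card.
set to := (_ \ _)%act; set N := 'C_G([set: {u | P u}] | to).
have nsN : N <| G.
  rewrite /normal subsetIl normsI ?normG //.
  apply: subset_trans (astab_norm _ _).
  by apply/subsetP=> a aG; rewrite !inE aG; apply/subsetP=> u; rewrite !inE.
suff N1 : N :=: 1 by rewrite /faithful -/N N1.
apply: (socle_meet nilG nsN); apply/trivgP; apply: subset_trans cap1.
apply/subsetP=> z /setIP[/setIP[zG zfix] zS]; rewrite mem_cap zS /=.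
apply/(all_nthP 1%G)=> i lti.
(* fixing the coset of the identity means belonging to the i-th member *)
pose j : 'I_n := Ordinal lti.
have Pj : P (j, K j : {set gT}).
  by apply/rcosetsP; exists 1; rewrite ?rcoset1.
pose u : {u | P u} :=
  exist (fun u => is_true (P u)) (j, K j : {set gT}) Pj.
have : to u z = u by apply: astab_act zfix _; rewrite inE.
move/(congr1 val); rewrite /= /ract val_subact (subsetP sGdom z zG) /=.
case=> /= eqK; rewrite -[nth _ _ _]/(K j).
by rewrite -[_ \in _]/(z \in (K j : {set gT})) -{}eqK rcoset_refl.
Qed.

Lemma minimal_family_of_action (gT : finGroupType) (G : {group gT})
    (T : finType) (to : action G T) :
  nilpotent G -> minimal_faithful to ->
  exists2 hs, minimal_family G hs
    & [seq #|G : (H : {group gT})| | H <- hs] = orbit_sizes to.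
Proof.
move=> nilG [ffulG minT]; have [hs fam_hs def_hs] := family_of_action ffulG.
exists hs => //; split=> // hs' /(action_of_family nilG)[T' [to' [fful' <-]]].
suff <- : #|T| = degree G hs by apply: minT fful'.
rewrite /degree -(big_map (fun H : {group gT} => #|G : H|) xpredT id) def_hs.
rewrite big_map big_enum /= acts_sum_card_orbit ?cardsT //.
by apply/subsetP=> a aG; rewrite !inE aG; apply/subsetP=> x; rewrite !inE.
Qed.

Lemma faithful_family_isog (gT gT' : finGroupType) (G : {group gT})
    (G' : {group gT'}) hs :
  G \isog G' -> faithful_family G hs ->
  exists2 hs', faithful_family G' hs'
    & [seq #|G' : (H : {group gT'})| | H <- hs']
      = [seq #|G : (H : {group gT})| | H <- hs].
Proof.
case/isogP=> f injf defG' /andP[sG cap1].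
exists [seq (f @* (H : {group gT}))%G | H <- hs]; last first.
  rewrite -map_comp; apply/eq_in_map=> H /(allP sG) sHG /=.
  by rewrite -defG' index_injm.
apply/andP; split.
  by apply/allP=> _ /mapP[H _ ->] /=; rewrite -defG' morphim_sub.
have defS : socle G' = (f @* socle G)%G.
  apply: group_inj; rewrite /= injm_Ohm ?center_sub // injm_center //.
  by rewrite defG'.
apply/subsetP=> y; rewrite mem_cap defS => /andP[/morphimP[x xG xS ->] fix_y].
have : x \in cap (socle G) hs.
  rewrite mem_cap xS; apply/allP=> H Hhs.
  have := allP fix_y _ (map_f _ Hhs).
  by case/morphimP=> w wG wH /(injmP injf) ->.
by move/(subsetP cap1)/set1P->; rewrite morph1 inE.
Qed.

Lemma minimal_family_isog (gT gT' : finGroupType) (G : {group gT})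
    (G' : {group gT'}) hs :
  G \isog G' -> minimal_family G hs ->
  exists2 hs', minimal_family G' hs'
    & [seq #|G' : (H : {group gT'})| | H <- hs']
      = [seq #|G : (H : {group gT})| | H <- hs].
Proof.
have degE (hT : finGroupType) (K : {group hT}) s :
    degree K s = sumn [seq #|K : (H : {group hT})| | H <- s].
  by rewrite sumnE big_map.
move=> isoG [fam_hs min_hs].
have [hs' fam_hs' eq_hs'] := faithful_family_isog isoG fam_hs.
exists hs' => //; split=> // s' fam_s'; rewrite isog_sym in isoG.
have [s fam_s eq_s] := faithful_family_isog isoG fam_s'.
by rewrite !degE eq_hs' -eq_s -!degE; apply: min_hs.
Qed.

(* The sum over all primes is cut at #|G|: if e_p > 0 then p divides #|G|. *)
Theorem theorem1p1 (gT : finGroupType) (G : {group gT})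
    (nilG : nilpotent G) (oddG : odd #|G|)
    (X : finType) (to : action G X) (minX : minimal_faithful to) :
  #|orbits to| = (\sum_(p < #|G|.+1 | prime p) center_rank G p)%N
  /\ forall (gT' : finGroupType) (G' : {group gT'})
            (X' : finType) (to' : action G' X'),
       G \isog G' -> minimal_faithful to' ->
       perm_eq (orbit_sizes to') (orbit_sizes to).
Proof.
have [hs min_hs def_hs] := minimal_family_of_action nilG minX.
split.
  rewrite -Omega_socle -(size_minimal_family oddG min_hs) cardE.
  by rewrite -(size_map (fun B : {set X} => #|B|)) -[map _ _]def_hs size_map.
move=> gT' G' X' to' isoG minX'.
have nilG' : nilpotent G' by rewrite -(isog_nil isoG).
have [hs' min_hs' <-] := minimal_family_of_action nilG' minX'.
rewrite isog_sym in isoG.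
have [hs'' min_hs'' <-] := minimal_family_isog isoG min_hs'.
by rewrite -def_hs minimal_family_indices.
Qed.
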